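(* Let $d\ge1$, $n\ge3$, $u\in\mathbb{C}\setminus\{0\}$ and let $z,x_1,\ldots,x_{d-1}\in\mathbb{C}$ be the parameters of the Markov trace $\mathrm{tr}$, with $x_0=1$. Then $\mathrm{tr}$ passes to the quotient algebra $\mathrm{CTL}_{d,n}(u)$ if and only if $$(u+1)z^2\sum_{k=0}^{d-1}x_k+(u+2)z\sum_{k=0}^{d-1}E^{(k)}+\sum_{k=0}^{d-1}\mathrm{tr}\big(e_1^{(k)}e_2\big)=0.$$
   Context: The Yokonuma–Hecke algebra $\mathrm{Y}_{d,n}(u)$ is the unital associative $\mathbb{C}$-algebra with generators $g_1,\ldots,g_{n-1},t_1,\ldots,t_n$ and relations: $g_ig_j=g_jg_i$ for $|i-j|>1$; $g_{i+1}g_ig_{i+1}=g_ig_{i+1}g_i$; $t_it_j=t_jt_i$; $t_i^d=1$; $g_it_i=t_{i+1}g_i$; $g_it_{i+1}=t_ig_i$; $g_it_j=t_jg_i$ for $j\ne i,i+1$; $g_i^2=1+(u-1)e_i+(u-1)e_ig_i$, where $e_i=\frac1d\sum_{s=0}^{d-1}t_i^st_{i+1}^{d-s}$; $\mathrm{Y}_{d,n}(u)\subset\mathrm{Y}_{d,n+1}(u)$ naturally. Also $e_i^{(m)}=\frac1d\sum_{s=0}^{d-1}t_i^{m+s}t_{i+1}^{d-s}$. For $w\in S_n$ with reduced expression $s_{i_1}\cdots s_{i_k}$ put $g_w=g_{i_1}\cdots g_{i_k}$; $g_{i,i+1}=\sum_{w\in\langle s_i,s_{i+1}\rangle}g_w$,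 and $c_{i,i+1}=\sum_{a,b,c=0}^{d-1}t_i^at_{i+1}^bt_{i+2}^c\,g_{i,i+1}$ for $1\le i\le n-2$. $\mathrm{CTL}_{d,n}(u)$ is the quotient of $\mathrm{Y}_{d,n}(u)$ by the two-sided ideal generated by all $c_{i,i+1}$. For complex $z,x_1,\ldots,x_{d-1}$, $\mathrm{tr}$ is the unique linear map on $\bigcup_n\mathrm{Y}_{d,n}(u)$ with $\mathrm{tr}(ab)=\mathrm{tr}(ba)$, $\mathrm{tr}(1)=1$, $\mathrm{tr}(ag_n)=z\,\mathrm{tr}(a)$, $\mathrm{tr}(at_{n+1}^s)=x_s\,\mathrm{tr}(a)$ for $a,b\in\mathrm{Y}_{d,n}(u)$. Indices of $x$ are taken mod $d$ and $E^{(m)}=\frac1d\sum_{s=0}^{d-1}x_{m+s}x_{d-s}$. ''$\mathrm{tr}$ passes to $\mathrm{CTL}_{d,n}(u)$'' means $\mathrm{tr}$ vanishes on the defining ideal. *)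

(* Defs.v *)
(* The base field C is kept generic (a fieldType) in the
   definitions; the theorem instantiates it with R[i] for R : realType,
   i.e. with the complex numbers. *)
From HB Require Import structures.
From mathcomp Require Import all_boot all_order all_algebra.
From mathcomp Require Import complex.
From mathcomp Require Import reals.
Set Implicit Arguments. Unset Strict Implicit. Unset Printing Implicit Defensive.
Import Order.TTheory GRing.Theory Num.Theory.
Local Open Scope ring_scope.

(* Letters of the (free) algebra: G i stands for g_i, T i for t_i
   (indices are 1-based, as in the paper). *)
Inductive letter := G of nat | T of nat.
Definition word := seq letter.

Definition inY (n : nat) (w : word) : Prop :=
  all (fun l => match l with
                | G i => (1 <= i <= n.-1)%N && (i < n)%N
                | T i => (1 <= i <= n)%N end) w.

Definition validw (w : word) : Prop := exists n, inY n w.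

Section FreeAlg.
Variable C : fieldType.

(* Elements of the free associative C-algebra on the letters, represented as
   formal linear combinations of words. *)
Definition fa := seq (C * word).
Definition fw (w : word) : fa := [:: (1, w)].
Definition fone : fa := fw [::].
Definition fadd (p q : fa) : fa := p ++ q.
Definition fscale (c : C) (p : fa) : fa := [seq (c * cw.1, cw.2) | cw <- p].
Definition fsub (p q : fa) : fa := p ++ fscale (-1) q.
Definition fmul (p q : fa) : fa :=
  [seq (a.1 * b.1, a.2 ++ b.2) | a <- p, b <- q].
Definition fsum (ps : seq fa) : fa := flatten ps.

Definition lin (tau : word -> C) (p : fa) : C := \sum_(cw <- p) cw.1 * tau cw.2.

Definition g (i : nat) : fa := fw [:: G i].
Definition tpow (i k : nat) : fa := fw (nseq k (T i)).

Definition e_m (d i m : nat) : fa :=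
  fscale (d%:R)^-1
    (fsum [seq fmul (tpow i (m + s)) (tpow i.+1 (d - s)) | s <- iota 0 d]).
Definition e_ (d i : nat) : fa := e_m d i 0.

Inductive YHrel (d : nat) (u : C) : fa -> Prop :=
| rel_gg i j : (1 <= i)%N -> (1 <= j)%N -> (1 < `|i - j|)%N ->
    YHrel d u (fsub (fmul (g i) (g j)) (fmul (g j) (g i)))
| rel_braid i : (1 <= i)%N ->
    YHrel d u (fsub (fmul (g i.+1) (fmul (g i) (g i.+1)))
                    (fmul (g i) (fmul (g i.+1) (g i))))
| rel_tt i j : (1 <= i)%N -> (1 <= j)%N ->
    YHrel d u (fsub (fmul (tpow i 1) (tpow j 1)) (fmul (tpow j 1) (tpow i 1)))
| rel_td i : (1 <= i)%N -> YHrel d u (fsub (tpow i d) fone)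
| rel_gt1 i : (1 <= i)%N ->
    YHrel d u (fsub (fmul (g i) (tpow i 1)) (fmul (tpow i.+1 1) (g i)))
| rel_gt2 i : (1 <= i)%N ->
    YHrel d u (fsub (fmul (g i) (tpow i.+1 1)) (fmul (tpow i 1) (g i)))
| rel_gt3 i j : (1 <= i)%N -> (1 <= j)%N -> j != i -> j != i.+1 ->
    YHrel d u (fsub (fmul (g i) (tpow j 1)) (fmul (tpow j 1) (g i)))
| rel_quad i : (1 <= i)%N ->
    YHrel d u (fsub (fmul (g i) (g i))
                    (fadd fone (fadd (fscale (u - 1) (e_ d i))
                                     (fscale (u - 1) (fmul (e_ d i) (g i)))))).

(* tau : word -> C, extended linearly, is the Markov trace tr on the union of
   the Y_{d,n}(u) with parameters z, x_1..x_{d-1} (x s is x_s for 1<=s<=d-1). *)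
Definition is_markov_trace (d : nat) (u z : C) (x : nat -> C)
    (tau : word -> C) : Prop :=
  [/\ (* tau is well defined on the quotient algebra: it kills the two-sided
         ideal generated by the defining relations *)
      (forall a b r, validw a -> validw b -> YHrel d u r ->
          lin tau (fmul (fmul (fw a) r) (fw b)) = 0),
      (forall a b, validw a -> validw b -> tau (a ++ b) = tau (b ++ a)),
      tau [::] = 1,
      (forall n a, (1 <= n)%N -> inY n a -> tau (rcons a (G n)) = z * tau a) &
      (forall n a s, (1 <= n)%N -> inY n a -> (1 <= s <= d.-1)%N ->
          tau (a ++ nseq s (T n.+1)) = x s * tau a)].

Definition xm (d : nat) (x : nat -> C) (k : nat) : C :=
  if (k %% d == 0)%N then 1 else x (k %% d)%N.

Definition Em (d : nat) (x : nat -> C) (m : nat) : C :=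
  (d%:R)^-1 * \sum_(s < d) xm d x (m + s) * xm d x (d - s).

(* g_{i,i+1} = sum over w in <s_i,s_{i+1}> of g_w
   = 1 + g_i + g_{i+1} + g_i g_{i+1} + g_{i+1} g_i + g_i g_{i+1} g_i *)
Definition g2 (i : nat) : fa :=
  fsum [:: fone; g i; g i.+1; fmul (g i) (g i.+1); fmul (g i.+1) (g i);
           fmul (g i) (fmul (g i.+1) (g i))].

Definition c2 (d i : nat) : fa :=
  fmul (fsum [seq fsum [seq fmul (tpow i a) (fmul (tpow i.+1 b) (tpow i.+2 c))
                       | b <- iota 0 d, c <- iota 0 d] | a <- iota 0 d]) (g2 i).

(* tr passes to CTL_{d,n}(u): it vanishes on the two-sided ideal of Y_{d,n}(u)
   generated by the c_{i,i+1}, 1 <= i <= n-2 (spanned by a c_{i,i+1} b for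
   words a, b of Y_{d,n}). *)
Definition passes_to_CTL (d n : nat) (tau : word -> C) : Prop :=
  forall i a b, (1 <= i <= n - 2)%N -> inY n a -> inY n b ->
    lin tau (fmul (fmul (fw a) (c2 d i)) (fw b)) = 0.

End FreeAlg.

Arguments fw {C}.
Arguments fone {C}.
Arguments g {C}.
Arguments tpow {C}.
Arguments e_m {C}.
Arguments e_ {C}.
Arguments g2 {C}.
Arguments c2 {C}.

(* Main.v *)
Require Import Defs.
From HB Require Import structures.
From mathcomp Require Import all_boot all_order all_algebra.
From mathcomp Require Import complex.
From mathcomp Require Import reals.
From mathcomp Require Import boolp zify ring.
Set Implicit Arguments. Unset Strict Implicit. Unset Printing Implicit Defensive.
Import GRing.Theory Num.Theory.
Local Open Scope ring_scope.

(* Dividing the free algebra by the radical of the trace form gives an honest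
   algebra in which the Yokonuma-Hecke relations hold and on which the trace is
   linear. There, with N_j = sum_k t_j^k, the element c_{i,i+1} is
   N_i N_{i+1} N_{i+2} g_{i,i+1}: it absorbs t_i, t_{i+1}, t_{i+2} and satisfies
   c_{i,i+1} g_j = u c_{i,i+1} for j = i, i+1, so on Y_{d,3}
   the form m |-> tr (c_{1,2} m) takes values proportional to tr c_{1,2}. The decomposition
   Y_{d,n+1} = Y_{d,n} g_n Y_{d,n} + sum_s Y_{d,n} t_{n+1}^s and the Markov
   property propagate this from Y_{d,3} to all Y_{d,n}. As u != 0 the g_i are
   invertible, and conjugation by g_i g_{i+1} g_{i+2} carries c_{i,i+1} to
   c_{i+1,i+2}. Hence the trace passes to the quotient iff tr c_{1,2} = 0, and
   tr c_{1,2} is d^2 times the left-hand side of the stated equation. *)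

(** * Sums of a periodic sequence over one period *)

Section PeriodicSums.
Variables (V : nmodType) (d : nat) (f : nat -> V).
Hypothesis f_per : forall k, f (k + d)%N = f k.

Lemma sum_shift s : \sum_(k < d) f (s + k)%N = \sum_(k < d) f k.
Proof.
case: d f_per => [|m] fp; first by rewrite !big_ord0.
elim: s => [|s IHs]; first by apply: eq_bigr.
rewrite -IHs big_ord_recr [RHS]big_ord_recl /= addrC addn0 addSnnS fp.
by congr (_ + _); apply: eq_bigr => k _; rewrite addSnnS.
Qed.

(** Reversing the index, [k] to [d-1-k], turns [d - k] into [k + 1], so what remains is a shift by
    [s.+1]. *)
Lemma sum_reflect s : \sum_(k < d) f (s + (d - k))%N = \sum_(k < d) f k.
Proof.
rewrite -(sum_shift s.+1) (reindex_inj rev_ord_inj) /=.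
by apply: eq_bigr => k _; congr f; have := ltn_ord k; lia.
Qed.

End PeriodicSums.

(** * Linear spans and the properties they inherit from their generators *)

Section LinearSpan.
Variables (C : fieldType) (A : algType C).

Inductive span (P : A -> Prop) : A -> Prop :=
| span_in a of P a : span P a
| span0 : span P 0
| spanD a b of span P a & span P b : span P (a + b)
| spanZ c a of span P a : span P (c *: a).

(** Linearity is asked of a bare function, so that maps such as [c |-> b * g * c * g] need no
    bundled linear structure. *)
Lemma span_lift (P Q : A -> Prop) (f : A -> A) :
    f 0 = 0 -> (forall a b, f (a + b) = f a + f b) ->
    (forall c a, f (c *: a) = c *: f a) ->
    (forall a, P a -> span Q (f a)) -> forall a, span P a -> span Q (f a).
Proof.
move=> f0 fD fZ PQ a; elim=> [b /PQ //||b c _ Hb _ Hc|c b _ Hb].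
- by rewrite f0; apply: span0.
- by rewrite fD; apply: spanD.
- by rewrite fZ; apply: spanZ.
Qed.

Lemma span_mulr (P Q : A -> Prop) y : (forall a, P a -> span Q (a * y)) ->
  forall a, span P a -> span Q (a * y).
Proof.
by apply: span_lift => *; rewrite ?mul0r ?mulrDl ?scalerAl.
Qed.

Lemma span_mull (P Q : A -> Prop) y : (forall a, P a -> span Q (y * a)) ->
  forall a, span P a -> span Q (y * a).
Proof.
by apply: span_lift => *; rewrite ?mulr0 ?mulrDr ?scalerAr.
Qed.

Lemma span_sum (P : A -> Prop) (I : Type) (r : seq I) (F : I -> A) :
  (forall i, span P (F i)) -> span P (\sum_(i <- r) F i).
Proof. by move=> PF; elim/big_rec: _ => [|i a _]; [apply: span0|apply: spanD]. Qed.

(** This is the common shape of both Markov rules; with [c = 0] it expresses that a trace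
    vanishes. *)
Lemma span_functional (P : A -> Prop) (f : {scalar A}) y c :
  (forall a, P a -> f (a * y) = c * f a) ->
  forall a, span P a -> f (a * y) = c * f a.
Proof.
move=> Pf a; elim=> [b /Pf //||b b' _ Hb _ Hb'|k b _ Hb].
- by rewrite mul0r !linear0 mulr0.
- by rewrite mulrDl !linearD /= Hb Hb' mulrDr.
- by rewrite -scalerAl !linearZ /= Hb mulrCA.
Qed.

Lemma span_comm (P : A -> Prop) y : (forall a, P a -> GRing.comm y a) ->
  forall a, span P a -> GRing.comm y a.
Proof.
move=> Py a; elim=> [b /Py //||b c _ Hb _ Hc|c b _ Hb].
- exact: commr0.
- exact: commrD.
- by rewrite /GRing.comm -scalerAl -scalerAr Hb.
Qed.

End LinearSpan.

(** * Powers and cyclic sums of an element whose order divides [d] *)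

Lemma exp_exchange (R : pzRingType) (x y w : R) k :
  x * y = w * x -> x * y ^+ k = w ^+ k * x.
Proof.
move=> xy; elim: k => [|k IHk]; first by rewrite mulr1 mul1r.
by rewrite !exprSr mulrA IHk -mulrA xy mulrA.
Qed.

Section CyclicSums.
Variables (C : fieldType) (A : algType C) (d : nat).
Hypothesis d_neq0 : d%:R != 0 :> C.

Definition csum (q : A) : A := \sum_(k < d) q ^+ k.

Lemma exp_per (q : A) k : q ^+ d = 1 -> q ^+ (k + d) = q ^+ k.
Proof. by move=> qd; rewrite exprD qd mulr1. Qed.

(** Since [q ^+ d = 1], the power [q ^+ d.-1] is the inverse of [q]; negative exponents are thus
    written [d - s]. *)
Lemma exp_pred (q : A) s : q ^+ d = 1 -> (s <= d)%N ->
  (q ^+ d.-1) ^+ s = q ^+ (d - s).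
Proof.
have dgt0 : (0 < d)%N by case: d d_neq0 => //; rewrite eqxx.
move=> qd sd; rewrite -exprM -exp_per //.
have -> : (d.-1 * s + d = d * s + (d - s))%N by nia.
by rewrite exprD exprM qd expr1n mul1r.
Qed.

Lemma csum_exchange (x q w : A) : x * q = w * x -> x * csum q = csum w * x.
Proof.
move=> xq; rewrite mulr_sumr mulr_suml; apply: eq_bigr => k _.
exact: exp_exchange.
Qed.

Lemma csum_absorb (q : A) k : q ^+ d = 1 -> csum q * q ^+ k = csum q.
Proof.
move=> qd; rewrite mulr_suml -[RHS](sum_shift (fun j => exp_per j qd) k).
by apply: eq_bigr => s _; rewrite -exprD addnC.
Qed.

Lemma csum_absorbed (y q : A) : y * q = y -> y * csum q = d%:R *: y.
Proof.
move=> yq; rewrite mulr_sumr (eq_bigr (fun=> y)).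
  by rewrite sumr_const card_ord scaler_nat.
by move=> k _; elim: (k : nat) => [|j IHj]; rewrite ?mulr1 // exprS mulrA yq.
Qed.

Lemma csum_sqr (q : A) : q ^+ d = 1 -> csum q * csum q = d%:R *: csum q.
Proof. by move=> qd; apply: csum_absorbed; rewrite -{2}(expr1 q) csum_absorb. Qed.

Lemma csum_inv (q : A) : q ^+ d = 1 -> csum (q ^+ d.-1) = csum q.
Proof.
move=> qd; rewrite -[RHS](sum_reflect (fun j => exp_per j qd) 0).
by apply: eq_bigr => s _; rewrite add0n exp_pred // ltnW.
Qed.

End CyclicSums.

(** * The Yokonuma-Hecke relations in an algebra: the idempotents e_i and the inverses of the g_i *)

Section YokonumaHecke.
Variables (C : fieldType) (A : algType C) (d : nat) (u : C) (g t idem : nat -> A).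
Hypothesis d_neq0 : d%:R != 0 :> C.
Hypothesis u_neq0 : u != 0.

Hypothesis ggC : forall i j, (0 < i)%N -> (i.+1 < j)%N -> g i * g j = g j * g i.
Hypothesis braid : forall i, (0 < i)%N ->
  g i.+1 * g i * g i.+1 = g i * g i.+1 * g i.
Hypothesis ttC : forall i j, (0 < i)%N -> (0 < j)%N -> t i * t j = t j * t i.
Hypothesis t_order : forall i, (0 < i)%N -> t i ^+ d = 1.
Hypothesis gt_l : forall i, (0 < i)%N -> g i * t i = t i.+1 * g i.
Hypothesis gt_r : forall i, (0 < i)%N -> g i * t i.+1 = t i * g i.
Hypothesis gt_far : forall i j, (0 < i)%N -> (0 < j)%N -> j != i -> j != i.+1 ->
  g i * t j = t j * g i.
Hypothesis idem_def : forall i, (0 < i)%N ->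
  idem i = d%:R^-1 *: \sum_(s < d) t i ^+ s * t i.+1 ^+ (d - s).
Hypothesis g_quad : forall i, (0 < i)%N ->
  g i * g i = 1 + (u - 1) *: idem i + (u - 1) *: (idem i * g i).

(** The quotient of t_i by t_{i+1}, with the inverse written as a power. Its order divides [d] and
    e_i is the average of its powers, which is why e_i is idempotent. *)
Definition tquo i : A := t i * t i.+1 ^+ d.-1.

Lemma tquo_order i : (0 < i)%N -> tquo i ^+ d = 1.
Proof.
move=> i0; rewrite exprMn_comm; last exact/commrX/ttC.
by rewrite -exprM mulnC exprM !t_order // expr1n mulr1.
Qed.

Lemma idemE i : (0 < i)%N -> idem i = d%:R^-1 *: csum d (tquo i).
Proof.
move=> i0; rewrite idem_def //; congr (_ *: _); apply: eq_bigr => s _.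
rewrite exprMn_comm; last exact/commrX/ttC.
by rewrite (exp_pred d_neq0) ?t_order // ltnW.
Qed.

Lemma idem_sqr i : (0 < i)%N -> idem i * idem i = idem i.
Proof.
move=> i0; rewrite idemE // -scalerAl -scalerAr csum_sqr ?tquo_order //.
by rewrite [X in _ *: X]scalerA mulVf // scale1r.
Qed.

Lemma tquo_inv i : (0 < i)%N -> t i.+1 * t i ^+ d.-1 = tquo i ^+ d.-1.
Proof.
move=> i0; have dgt0 : (0 < d)%N by case: d d_neq0 => //; rewrite eqxx.
rewrite exprMn_comm; last exact/commrX/ttC.
rewrite (exp_pred d_neq0) ?t_order // ?leq_pred //.
have -> : (d - d.-1 = 1)%N by lia.
by rewrite (exp_exchange _ (w := t i)) ?expr1 // ttC.
Qed.

(** Conjugation by g_i swaps t_i and t_{i+1}, hence inverts [tquo i], and this only permutes the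
    powers that are averaged in e_i. *)
Lemma g_idem i : (0 < i)%N -> g i * idem i = idem i * g i.
Proof.
move=> i0; rewrite idemE // -scalerAl -scalerAr; congr (_ *: _).
rewrite (csum_exchange d (w := tquo i ^+ d.-1)) ?csum_inv ?tquo_order //.
by rewrite -tquo_inv // mulrA gt_l // -mulrA (exp_exchange _ (gt_r _)) // mulrA.
Qed.

(** The quadratic relation gives (g_i - (u-1)e_i) g_i = 1 + (u-1)e_i. As e_i is idempotent and u is
    nonzero, the right side has inverse 1 + (u^{-1} - 1)e_i. *)
Definition ginv i : A :=
  (1 + (u^-1 - 1) *: idem i) * (g i - (u - 1) *: idem i).

Lemma mulVg i : (0 < i)%N -> ginv i * g i = 1.
Proof.
move=> i0; rewrite -mulrA mulrBl g_quad // -scalerAl addrK.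
rewrite mulrDl mul1r mulrDr mulr1 -scalerAl -scalerAr idem_sqr // scalerA.
rewrite -addrA -!scalerDl [X in X *: _](_ : _ = 0) ?scale0r ?addr0 //.
by field.
Qed.

(** [ginv i] is a polynomial in g_i and e_i, which commute, so the left inverse is also a right
    inverse. *)
Lemma mulgV i : (0 < i)%N -> g i * ginv i = 1.
Proof.
move=> i0; rewrite -[RHS](mulVg i0); apply/commr_sym/commr_sym.
have ge : GRing.comm (g i) (idem i) by exact: g_idem.
have geZ c : GRing.comm (g i) (c *: idem i).
  by rewrite /GRing.comm -scalerAl -scalerAr ge.
by apply: commrM; [apply: commrD (commr1 _) _|apply: commrB].
Qed.

(** * The element c_{i,i+1}: absorption, the eigenvalue u, and conjugation to c_{i+1,i+2} *)

Notation T3 i := (csum d (t i) * csum d (t i.+1) * csum d (t i.+2)).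

Lemma tsumC i j : (0 < i)%N -> (0 < j)%N ->
  csum d (t i) * csum d (t j) = csum d (t j) * csum d (t i).
Proof.
by move=> i0 j0; apply: csum_exchange; apply/esym/csum_exchange/ttC.
Qed.

Lemma tsum_t i j : (0 < i)%N -> (0 < j)%N ->
  csum d (t i) * t j = t j * csum d (t i).
Proof. by move=> i0 j0; apply/esym/csum_exchange/ttC. Qed.

Lemma g_tsum_l i : (0 < i)%N -> g i * csum d (t i) = csum d (t i.+1) * g i.
Proof. by move=> i0; apply/csum_exchange/gt_l. Qed.

Lemma g_tsum_r i : (0 < i)%N -> g i * csum d (t i.+1) = csum d (t i) * g i.
Proof. by move=> i0; apply/csum_exchange/gt_r. Qed.

Lemma g_tsum_far i j : (0 < i)%N -> (0 < j)%N -> j != i -> j != i.+1 ->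
  g i * csum d (t j) = csum d (t j) * g i.
Proof. by move=> *; apply/csum_exchange/gt_far. Qed.

Lemma tsum_absorb i : (0 < i)%N -> csum d (t i) * t i = csum d (t i).
Proof. by move=> i0; rewrite -{2}(expr1 (t i)) csum_absorb ?t_order. Qed.

Lemma T3_t i j : (0 < i)%N -> (i <= j <= i.+2)%N -> T3 i * t j = T3 i.
Proof.
move=> i0 ij; have [->|[->|->]] : j = i \/ j = i.+1 \/ j = i.+2 by lia.
- by rewrite -!mulrA !(tsum_t (j := i)) // [csum d (t i.+1) * _]mulrA
     tsum_t // !mulrA tsum_absorb.
- by rewrite -!mulrA tsum_t // [csum d (t i.+1) * _]mulrA tsum_absorb.
- by rewrite -!mulrA tsum_absorb.
Qed.

(** Passing g_j through the product swaps the factors N_j and N_{j+1} and fixes the third; the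
    factors commute. *)
Lemma T3_g i j : (0 < i)%N -> (i <= j <= i.+1)%N -> g j * T3 i = T3 i * g j.
Proof.
move=> i0 ij; have [->|->] : j = i \/ j = i.+1 by lia.
  rewrite !mulrA g_tsum_l // -[csum _ _ * _ * _]mulrA g_tsum_r // mulrA.
  by rewrite tsumC // -[LHS]mulrA g_tsum_far ?mulrA //; lia.
rewrite !mulrA g_tsum_far //; try lia.
rewrite -[csum _ _ * _ * _]mulrA g_tsum_l // mulrA -[LHS]mulrA g_tsum_r //.
by rewrite -!mulrA; congr (_ * _); rewrite !mulrA tsumC.
Qed.

(** Isolated from c_{i,i+1} because it is stable under right multiplication by g_i and g_{i+1}, and
    so holds for every summand of c_{i,i+1}. *)
Definition absorbs i (y : A) : Prop :=
  forall j, (i <= j <= i.+2)%N -> y * t j = y.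

Lemma absorbs_g i j y : (0 < i)%N -> (i <= j <= i.+1)%N ->
  absorbs i y -> absorbs i (y * g j).
Proof.
move=> i0 ij Hy k ik; have [->|kj] := eqVneq k j.
  by rewrite -mulrA gt_l ?mulrA ?Hy //; lia.
have [->|kj1] := eqVneq k j.+1.
  by rewrite -mulrA gt_r ?mulrA ?Hy //; lia.
by rewrite -mulrA gt_far ?mulrA ?Hy //; lia.
Qed.

(** Absorption gives y e_j = y, so after y the quadratic relation becomes that of the ordinary Hecke
    algebra, g_j^2 = u + (u-1) g_j. *)
Lemma absorbs_quad i j y : (0 < i)%N -> (i <= j <= i.+1)%N ->
  absorbs i y -> y * g j * g j = u *: y + (u - 1) *: (y * g j).
Proof.
move=> i0 ij Hy; have yX k s : (i <= k <= i.+2)%N -> y * t k ^+ s = y.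
  by move=> ik; elim: s => [|s IHs]; rewrite ?mulr1 // exprS mulrA Hy.
have ye : y * idem j = y.
  rewrite idemE; last lia.
  rewrite -scalerAr csum_absorbed ?scalerA ?mulVf ?scale1r //.
  by rewrite mulrA Hy ?yX //; lia.
rewrite -mulrA g_quad; last lia.
rewrite !mulrDr mulr1 -!scalerAr mulrA ye -[X in X + _ + _]scale1r -scalerDl.
by congr (_ *: _ + _); ring.
Qed.

Definition gsum i : A :=
  1 + g i + g i.+1 + g i * g i.+1 + g i.+1 * g i + g i * g i.+1 * g i.

Definition ctl i : A := T3 i * gsum i.

Lemma T3_absorbs i : (0 < i)%N -> absorbs i (T3 i).
Proof. by move=> i0 j ij; apply: T3_t. Qed.

Lemma ctl_t i j : (0 < i)%N -> (i <= j <= i.+2)%N -> ctl i * t j = ctl i.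
Proof.
move=> i0 ij; have a0 := T3_absorbs i0.
have a_ k := absorbs_g (j := k) i0.
rewrite /ctl /gsum !mulrDr mulr1 !mulrDl !mulrA a0 //.
by rewrite !(a_ _ _ _ a0, a_ _ _ _ (a_ _ _ _ a0),
  a_ _ _ _ (a_ _ _ _ (a_ _ _ _ a0))) //; lia.
Qed.

(** The six elements of the symmetric group on three letters split into pairs w, w s_j. Each pair
    contributes y + y g_j with y absorbing, and right multiplication by g_j scales this by u. *)
Lemma ctl_g i j : (0 < i)%N -> (i <= j <= i.+1)%N ->
  ctl i * g j = u *: ctl i.
Proof.
move=> i0 ij.
suff pair y : absorbs i y -> (y + y * g j) * g j = u *: (y + y * g j).
  have a0 := T3_absorbs i0.
  have ai : absorbs i (T3 i * g i) by apply: absorbs_g => //; lia.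
  have ai1 : absorbs i (T3 i * g i.+1) by apply: absorbs_g => //; lia.
  have aii1 : absorbs i (T3 i * g i * g i.+1) by apply: absorbs_g => //; lia.
  have ai1i : absorbs i (T3 i * g i.+1 * g i) by apply: absorbs_g => //; lia.
  have [ji|ji] : j = i \/ j = i.+1 by lia.
    have -> : ctl i = (T3 i + T3 i * g j) + (T3 i * g i.+1 + T3 i * g i.+1 * g j)
        + (T3 i * g i * g i.+1 + T3 i * g i * g i.+1 * g j).
      rewrite ji /ctl /gsum !mulrDr mulr1 !mulrA -!addrA.
      by congr (_ + (_ + (_ + _))); rewrite addrCA.
    by rewrite mulrDl [X in X + _]mulrDl !scalerDr !pair ?scalerDr.
  (* For j = i+1 the braid relation rewrites the longest element so that it ends in g_{i+1}. *)
  have -> : ctl i = (T3 i + T3 i * g j) + (T3 i * g i + T3 i * g i * g j)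
        + (T3 i * g i.+1 * g i + T3 i * g i.+1 * g i * g j).
    rewrite ji /ctl /gsum -braid // !mulrDr mulr1 !mulrA -!addrA.
    by congr (_ + _); rewrite addrCA.
  by rewrite mulrDl [X in X + _]mulrDl !scalerDr !pair ?scalerDr.
move=> Hy; rewrite mulrDl (absorbs_quad i0 ij Hy) addrCA -[X in _ + (X + _)]scale1r.
by rewrite -scalerDl scalerDr; congr (_ + _ *: _); ring.
Qed.

Lemma g_shift i : (0 < i)%N -> let h := g i * g i.+1 * g i.+2 in
  h * g i = g i.+1 * h /\ h * g i.+1 = g i.+2 * h.
Proof.
move=> i0 h; split.
  by rewrite /h -mulrA -(ggC (j := i.+2)) // !mulrA braid.
rewrite /h -2!mulrA [g i.+1 * _]mulrA -braid // !mulrA; congr (_ * _ * _).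
exact: ggC.
Qed.

(** The permutation underlying h sends i, i+1, i+2 to i+1, i+2, i+3: one factor of h raises the
    index of t_j and the other two commute with it, as in each of the three cases. *)
Lemma t_shift i j : (0 < i)%N -> (i <= j <= i.+2)%N ->
  let h := g i * g i.+1 * g i.+2 in h * t j = t j.+1 * h.
Proof.
move=> i0 ij h; have [->|[->|->]] : j = i \/ j = i.+1 \/ j = i.+2 by lia.
- rewrite /h -!mulrA (gt_far (i := i.+2)) //; try lia.
  rewrite [g i.+1 * _]mulrA (gt_far (i := i.+1)) //; try lia.
  by rewrite !mulrA gt_l.
- rewrite /h -!mulrA (gt_far (i := i.+2)) //; try lia.
  rewrite [g i.+1 * _]mulrA gt_l // !mulrA gt_far //; lia.
rewrite /h -!mulrA gt_l // [g i.+1 * _]mulrA gt_far //; try lia.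
by rewrite !mulrA gt_far //; lia.
Qed.

Lemma ctl_shift i : (0 < i)%N -> let h := g i * g i.+1 * g i.+2 in
  h * ctl i = ctl i.+1 * h.
Proof.
move=> i0 h; have [hi hi1] := g_shift i0.
have hT j : (i <= j <= i.+2)%N -> h * csum d (t j) = csum d (t j.+1) * h.
  by move=> ij; apply/csum_exchange/t_shift.
(* Only the exchange relations of [h] matter from here on, so its expression is forgotten. *)
rewrite -/h in hi hi1; move: (h) hi hi1 hT => {}h hi hi1 hT.
rewrite /ctl mulrA; have -> : h * T3 i = T3 i.+1 * h.
  rewrite !mulrA hT; last lia.
  rewrite -[csum _ _ * _ * _]mulrA hT; last lia.
  rewrite mulrA -[LHS]mulrA hT; last lia.
  by rewrite mulrA.
rewrite -[LHS]mulrA -[RHS]mulrA; congr (_ * _).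
rewrite /gsum !mulrDr !mulrDl mulr1 mul1r hi hi1.
have M a b a' b' : h * a = a' * h -> h * b = b' * h -> h * (a * b) = a' * b' * h.
  by move=> Ha Hb; rewrite mulrA Ha -mulrA Hb mulrA.
by rewrite (M _ _ _ _ hi hi1) (M _ _ _ _ hi1 hi) (M _ _ _ _ (M _ _ _ _ hi hi1) hi).
Qed.

(** * The subalgebras Y_{d,n} and the decomposition of Y_{d,n+1} over Y_{d,n} *)

Definition ev (w : word) : A :=
  \prod_(l <- w) match l with G i => g i | T i => t i end.

Lemma ev_cat w1 w2 : ev (w1 ++ w2) = ev w1 * ev w2.
Proof. exact: big_cat. Qed.

(** The image of Y_{d,n}, taken as a predicate on the single algebra [A], so that the inclusions of
    the tower are implications. *)
Definition subY n : A -> Prop := span (fun a => exists2 w, inY n w & a = ev w).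

Lemma subY_ev n w : inY n w -> subY n (ev w).
Proof. by move=> nw; apply: span_in; exists w. Qed.

Lemma subY1 n : subY n 1.
Proof.
have -> : 1 = ev [::] by rewrite /ev big_nil.
exact: subY_ev.
Qed.

Lemma subY_g n i : (0 < i < n)%N -> subY n (g i).
Proof.
move=> ni; have -> : g i = ev [:: G i] by rewrite /ev big_seq1.
by apply: subY_ev; rewrite /inY /=; lia.
Qed.

Lemma subY_t n i : (0 < i <= n)%N -> subY n (t i).
Proof.
move=> ni; have -> : t i = ev [:: T i] by rewrite /ev big_seq1.
by apply: subY_ev; rewrite /inY /= ni.
Qed.

Lemma subYM n a b : subY n a -> subY n b -> subY n (a * b).
Proof.
move=> + nb; apply: span_mulr => _ [w nw ->]; move: b nb.
apply: span_mull => _ [w' nw' ->]; rewrite -ev_cat; apply: subY_ev.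
by rewrite /inY all_cat; apply/andP.
Qed.

Lemma subYX n a k : subY n a -> subY n (a ^+ k).
Proof.
move=> na; elim: k => [|k IHk]; first exact: subY1.
by rewrite exprS; apply: subYM.
Qed.

Lemma subY_csum n a : subY n a -> subY n (csum d a).
Proof. by move=> na; apply: span_sum => k; apply: subYX. Qed.

Lemma subY_idem n i : (0 < i < n)%N -> subY n (idem i).
Proof.
move=> ni; rewrite idemE; last lia.
by apply/spanZ/subY_csum/subYM; [|apply: subYX]; apply: subY_t; lia.
Qed.

Lemma subY_ginv n i : (0 < i < n)%N -> subY n (ginv i).
Proof.
move=> ni; have ne := subY_idem ni; apply: subYM; apply: spanD.
- exact: subY1.
- exact: spanZ.
- exact: subY_g.
by rewrite -scaleNr; apply: spanZ.
Qed.

Lemma subY_ctl n i : (0 < i)%N -> (i.+2 <= n)%N -> subY n (ctl i).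
Proof.
move=> i0 ni.
have ngi : subY n (g i) by apply: subY_g; lia.
have ngi1 : subY n (g i.+1) by apply: subY_g; lia.
have nt j : (i <= j <= i.+2)%N -> subY n (csum d (t j)).
  by move=> ij; apply/subY_csum/subY_t; lia.
apply: subYM; first by do 2?apply: subYM; apply: nt; lia.
by do ![apply: spanD]; do ?[apply: subYM] => //; apply: subY1.
Qed.

Lemma subYW n m a : (n <= m)%N -> subY n a -> subY m a.
Proof.
move=> nm; elim=> [_ [w nw ->]||b c _ Hb _ Hc|c b _ Hb].
- apply: subY_ev; apply: sub_all nw => -[] i; lia.
- exact: span0.
- exact: spanD.
- exact: spanZ.
Qed.

Lemma subY_comm n y :
    (forall i, (0 < i < n)%N -> y * g i = g i * y) ->
    (forall i, (0 < i <= n)%N -> y * t i = t i * y) ->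
  forall a, subY n a -> y * a = a * y.
Proof.
move=> yg yt; apply: span_comm => _ [w + ->]; rewrite /ev.
elim: w => [|l w IHw]; first by rewrite big_nil => _; apply: commr1.
rewrite /inY /= => /andP[nl nw]; rewrite big_cons; apply: commrM (IHw nw).
by case: l nl => i ni; [apply: yg; lia|apply: yt].
Qed.

Lemma t_subY n a : subY n a -> t n.+1 * a = a * t n.+1.
Proof.
by apply: subY_comm => i ni; [rewrite gt_far //; lia|rewrite ttC //; lia].
Qed.

Lemma g_subY n a : subY n a -> g n.+1 * a = a * g n.+1.
Proof.
apply: subY_comm => i ni; last by rewrite gt_far //; lia.
by rewrite -(ggC (j := n.+1)) //; lia.
Qed.

(** The two shapes on which the Markov rules evaluate a trace, after a cyclic permutation in the
    first one. The condition [0 < n] excludes g_0. *)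
Definition markov_piece n (a : A) : Prop :=
  (exists b c, [/\ (0 < n)%N, subY n b, subY n c & a = b * g n * c]) \/
  (exists b s, subY n b /\ a = b * t n.+1 ^+ s).

Lemma pieceP_t n b s : subY n b -> span (markov_piece n) (b * t n.+1 ^+ s).
Proof. by move=> nb; apply: span_in; right; exists b, s. Qed.

Lemma pieceP_g n b c : (0 < n)%N -> subY n b -> subY n c ->
  span (markov_piece n) (b * g n * c).
Proof. by move=> n0 nb nc; apply: span_in; left; exists b, c. Qed.

(** Expand g_n^2. In the e_n term the powers of t_n join b; in the e_n g_n term the powers of
    t_{n+1} cross g_n and become powers of t_n on its right. *)
Lemma piece_quad n b s : (0 < n)%N -> subY n b ->
  span (markov_piece n) (b * t n.+1 ^+ s * (g n * g n)).
Proof.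
move=> n0 nb; have tt k s' : t n.+1 ^+ s' * t n ^+ k = t n ^+ k * t n.+1 ^+ s'.
  by apply/commrX/commr_sym/commrX/ttC.
have ntn k : subY n (t n ^+ k) by apply/subYX/subY_t; lia.
rewrite g_quad // !mulrDr mulr1 -!scalerAr; apply: spanD; first apply: spanD.
- exact: pieceP_t.
- apply: spanZ; rewrite idem_def // -scalerAr; apply: spanZ.
  rewrite mulr_sumr; apply: span_sum => k.
  rewrite mulrA -(mulrA b) tt (mulrA b) -[X in span _ X]mulrA -exprD.
  by apply: pieceP_t; apply: subYM.
apply: spanZ; rewrite idem_def // -scalerAl -scalerAr; apply: spanZ.
rewrite mulr_suml mulr_sumr; apply: span_sum => k.
have -> : b * t n.+1 ^+ s * (t n ^+ k * t n.+1 ^+ (d - k) * g n) =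
          b * t n ^+ k * g n * t n ^+ (s + (d - k)).
  rewrite -[RHS]mulrA (exp_exchange _ (gt_l n0)) exprD !mulrA.
  by rewrite -[b * _ * t n ^+ k]mulrA tt mulrA.
by apply: pieceP_g => //; apply: subYM.
Qed.

(** A middle factor c1 g_n c2 is handled by the braid relation, since c1 and c2 commute with
    g_{n+1}. A middle factor c1 t_{n+1}^s lets t cross g_{n+1}, leaving g_{n+1}^2. *)
Lemma piece_gYg n b c : subY n.+1 b -> span (markov_piece n) c ->
  span (markov_piece n.+1) (b * g n.+1 * c * g n.+1).
Proof.
move=> nb; apply: (span_lift (f := fun c => b * g n.+1 * c * g n.+1)).
- by rewrite mulr0 mul0r.
- by move=> *; rewrite mulrDr mulrDl.
- by move=> *; rewrite -scalerAr -scalerAl.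
move=> _ [[c1 [c2 [n0 n1 n2 ->]]]|[c1 [s [n1 ->]]]].
  have -> : b * g n.+1 * (c1 * g n * c2) * g n.+1 =
            (b * c1 * g n) * g n.+1 * (g n * c2).
    rewrite -!mulrA -(g_subY n2) [g n.+1 * (c1 * _)]mulrA g_subY // -!mulrA.
    by do 2!congr (_ * _); rewrite !mulrA braid.
  have nW a : subY n a -> subY n.+1 a by apply: subYW; lia.
  have ng : subY n.+1 (g n) by apply: subY_g; lia.
  by apply: pieceP_g => //; do !apply: subYM => //; apply: nW.
have -> : b * g n.+1 * (c1 * t n.+1 ^+ s) * g n.+1 =
          b * c1 * t n.+2 ^+ s * (g n.+1 * g n.+1).
  rewrite -(mulrA b) [g n.+1 * _]mulrA g_subY // -[c1 * _ * _]mulrA.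
  by rewrite (exp_exchange _ (gt_l _)) // !mulrA.
by apply: piece_quad => //; apply: subYM => //; apply: subYW n1.
Qed.

(** Induction on n, then on the word: right multiplication by each letter preserves the span. The
    base case is Y_{d,1}, generated by t_1 alone. *)
Lemma subY_span n a : subY n.+1 a -> span (markov_piece n) a.
Proof.
elim: n a => [|n IHn] a; elim=> [_ [w + ->]||b c _ Hb _ Hc|c b _ Hb];
  try by [apply: span0|apply: spanD|apply: spanZ].
  elim/last_ind: w => [_|w l IHw].
    rewrite /ev big_nil -[1]mulr1 -(expr0 (t 1%N)).
    by apply: pieceP_t; apply: subY1.
  rewrite /inY all_rcons => /andP[nl /IHw].
  rewrite -cats1 ev_cat [ev [:: l]]big_seq1; apply: span_mulr.
  move=> _ [[? [? [] //]]|[b [s [nb ->]]]].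
  case: l nl => i; first lia.
  move=> i1; have -> : i = 1%N by lia.
  by rewrite -mulrA -exprSr; apply: pieceP_t.
elim/last_ind: w => [_|w l IHw].
  rewrite /ev big_nil -[1]mulr1 -(expr0 (t n.+2)).
  by apply: pieceP_t; apply: subY1.
rewrite /inY all_rcons => /andP[nl /IHw].
rewrite -cats1 ev_cat [ev [:: l]]big_seq1; apply: span_mulr.
case: l nl => i ni.
  have [->|i_n] := eqVneq i n.+1.
    move=> _ [[b [c [_ nb nc ->]]]|[b [s [nb ->]]]].
      (* Two factors g_{n+1} enclose an element of Y_{d,n+1}, which the outer induction hypothesis
         decomposes. *)
      by apply: piece_gYg => //; apply: IHn.
    rewrite -mulrA -(exp_exchange _ (gt_l _)) // mulrA.
    by apply: pieceP_g => //; apply/subYX/subY_t; lia.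
  have ng : subY n.+1 (g i) by apply: subY_g; lia.
  move=> _ [[b [c [_ nb nc ->]]]|[b [s [nb ->]]]].
    by rewrite -mulrA; apply: pieceP_g => //; apply: subYM.
  rewrite -mulrA -(exp_exchange (x := g i) (y := t n.+2)) ?mulrA.
    by apply: pieceP_t; apply: subYM.
  by rewrite gt_far //; lia.
have [->|i_n] := eqVneq i n.+2.
  move=> _ [[b [c [_ nb nc ->]]]|[b [s [nb ->]]]].
    rewrite -mulrA -t_subY // mulrA -(mulrA b) gt_r // mulrA.
    by apply: pieceP_g => //; apply: subYM => //; apply: subY_t; lia.
  by rewrite -mulrA -exprSr; apply: pieceP_t.
have nt : subY n.+1 (t i) by apply: subY_t; lia.
move=> _ [[b [c [_ nb nc ->]]]|[b [s [nb ->]]]].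
  by rewrite -mulrA; apply: pieceP_g => //; apply: subYM.
rewrite -mulrA -(exp_exchange (x := t i) (y := t n.+2)) ?mulrA.
  by apply: pieceP_t; apply: subYM.
by rewrite ttC //; lia.
Qed.

(** * The trace of c_{1,2} and its propagation to the whole ideal *)

Variables (z : C) (x : nat -> C) (tr : {scalar A}).
Hypothesis trC : forall a b, tr (a * b) = tr (b * a).
Hypothesis tr1 : tr 1 = 1.
Hypothesis tr_g : forall n w, (0 < n)%N -> inY n w ->
  tr (ev w * g n) = z * tr (ev w).
Hypothesis tr_t : forall n w s, (0 < n)%N -> inY n w -> (1 <= s <= d.-1)%N ->
  tr (ev w * t n.+1 ^+ s) = x s * tr (ev w).

Lemma tr_subY_g n a : (0 < n)%N -> subY n a -> tr (a * g n) = z * tr a.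
Proof. by move=> n0; apply: span_functional => _ [w nw ->]; apply: tr_g. Qed.

(** The exponent is reduced modulo [d], as the rule [tr_t] covers only 1 to d-1; a residue 0 agrees
    with x_0 = 1. *)
Lemma tr_subY_t n a s : (0 < n)%N -> subY n a ->
  tr (a * t n.+1 ^+ s) = xm d x s * tr a.
Proof.
move=> n0; apply: span_functional => _ [w nw ->].
rewrite {1}(divn_eq s d) exprD mulnC exprM t_order // expr1n mul1r /xm.
have [->|s0] := eqVneq (s %% d)%N 0; first by rewrite mulr1 mul1r.
have d0 : (0 < d)%N by case: d d_neq0 => //; rewrite eqxx.
by apply: tr_t => //; have := ltn_pmod s d0; lia.
Qed.

Local Notation xs := (\sum_(k < d) xm d x k).

Lemma tr_subY_csum n a : (0 < n)%N -> subY n a ->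
  tr (a * csum d (t n.+1)) = xs * tr a.
Proof.
move=> n0 na; rewrite mulr_sumr linear_sum mulr_suml.
by apply: eq_bigr => k _; apply: tr_subY_t.
Qed.

(** The rule for t_{n+1} starts at t_2, so t_1 is first conjugated to t_2 by the invertible g_1. *)
Lemma tr_t1 s : tr (t 1%N ^+ s) = xm d x s.
Proof.
rewrite -[t 1%N ^+ s]mul1r -(mulVg (i := 1)) // -mulrA trC.
rewrite (exp_exchange _ (gt_l _)) // -mulrA mulgV // mulr1.
by rewrite -[t 2 ^+ s]mul1r tr_subY_t ?tr1 ?mulr1 //; apply: subY1.
Qed.

Lemma subY_tsum n i : (0 < i <= n)%N -> subY n (csum d (t i)).
Proof. by move=> ni; apply/subY_csum/subY_t. Qed.

Lemma tr_tsum1 : tr (csum d (t 1%N)) = xs.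
Proof. by rewrite linear_sum; apply: eq_bigr => k _; apply: tr_t1. Qed.

Lemma tr_tsum2 : tr (csum d (t 1%N) * csum d (t 2)) = xs ^+ 2.
Proof. by rewrite tr_subY_csum ?tr_tsum1 ?expr2 //; apply: subY_tsum. Qed.

Lemma tr_T3 : tr (T3 1%N) = xs ^+ 3.
Proof.
rewrite tr_subY_csum ?tr_tsum2 -?exprS //.
by apply: subYM; apply: subY_tsum.
Qed.

(** N_2 crosses g_1 and becomes N_1; by cyclicity it meets the other N_1, and N_1^2 = d N_1 lies in
    Y_{d,1}, where the Markov rule for g_1 applies. *)
Lemma tr_tsum2_g1 : tr (csum d (t 1%N) * csum d (t 2) * g 1%N) = z * (d%:R * xs).
Proof.
rewrite -mulrA -g_tsum_l // [_ * (g _ * _)]mulrA trC [_ * (_ * g _)]mulrA.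
rewrite tr_subY_g //.
  by rewrite csum_sqr ?t_order // linearZ /= tr_tsum1.
by apply: subYM; apply: subY_tsum.
Qed.

Lemma tr_T3_g1 : tr (T3 1%N * g 1%N) = z * d%:R * xs ^+ 2.
Proof.
rewrite -mulrA -g_tsum_far // mulrA tr_subY_csum // ?tr_tsum2_g1; first by ring.
by apply: subYM; [apply: subYM; apply: subY_tsum|apply: subY_g].
Qed.

(** N_3 passes a and turns into N_2 when crossing g_2; by cyclicity it merges with the first N_2,
    giving the factor d. What remains is an element of Y_{d,2} times g_2. *)
Lemma tr_T3_mul_g2 a : subY 2 a -> a * t 3 = t 3 * a ->
  tr (T3 1%N * (a * g 2)) = z * (d%:R * tr (csum d (t 1%N) * csum d (t 2) * a)).
Proof.
move=> na a3; have -> : T3 1%N * (a * g 2) =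
    csum d (t 1%N) * csum d (t 2) * a * g 2 * csum d (t 2).
  rewrite -[in RHS]mulrA g_tsum_l // -!mulrA; do 2!congr (_ * _).
  by rewrite !mulrA -(csum_exchange _ a3).
rewrite trC; set y := _ * _ * a.
have -> : csum d (t 2) * (y * g 2) = d%:R *: (y * g 2).
  rewrite /y !mulrA (tsumC (i := 2) (j := 1)) // -(mulrA (csum d (t 1%N))).
  by rewrite csum_sqr ?t_order // -scalerAr -!scalerAl.
rewrite linearZ /= tr_subY_g //; first by rewrite mulrCA.
by apply: subYM => //; apply: subYM; apply: subY_tsum.
Qed.

Lemma tr_T3_g2 : tr (T3 1%N * g 2) = z * d%:R * xs ^+ 2.
Proof.
rewrite -[g 2]mul1r tr_T3_mul_g2; last by rewrite mulr1 mul1r.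
  by rewrite mulr1 tr_tsum2; ring.
exact: subY1.
Qed.

Lemma tr_T3_g1g2 : tr (T3 1%N * (g 1%N * g 2)) = z ^+ 2 * d%:R ^+ 2 * xs.
Proof.
rewrite tr_T3_mul_g2 ?tr_tsum2_g1; first by ring.
- by apply: subY_g.
- exact: gt_far.
Qed.

Lemma tr_T3_g2g1 : tr (T3 1%N * (g 2 * g 1%N)) = z ^+ 2 * d%:R ^+ 2 * xs.
Proof. by rewrite mulrA trC mulrA T3_g // -[T3 1 * _ * _]mulrA tr_T3_g1g2. Qed.

(** Cyclicity brings the two g_1 together, and [T3 1] absorbs, so the Hecke quadratic relation
    applies. *)
Lemma tr_T3_g1g2g1 : tr (T3 1%N * (g 1%N * g 2 * g 1%N)) =
  u * (z * d%:R * xs ^+ 2) + (u - 1) * (z ^+ 2 * d%:R ^+ 2 * xs).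
Proof.
rewrite [T3 1 * _]mulrA trC [g 1 * (T3 1 * _)]mulrA T3_g // [T3 1 * g 1 * _]mulrA.
rewrite (absorbs_quad (i := 1)) //; last exact: T3_absorbs.
rewrite mulrDl -!scalerAl linearD !linearZ /= tr_T3_g2.
by rewrite -[T3 1 * _ * _]mulrA tr_T3_g1g2.
Qed.

Lemma tr_ctl1 : tr (ctl 1) = (u + 1) * z ^+ 2 * d%:R ^+ 2 * xs
  + (u + 2) * z * d%:R * xs ^+ 2 + xs ^+ 3.
Proof.
rewrite /ctl /gsum !mulrDr mulr1 !linearD /= tr_T3 tr_T3_g1 tr_T3_g2.
by rewrite tr_T3_g1g2 tr_T3_g2g1 tr_T3_g1g2g1; ring.
Qed.

(** On Y_{d,3} each letter acts on c_{1,2} by 1 or u, so only tr c_{1,2} remains. Above that level,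
    m is decomposed, and cyclicity exposes the last g or t to a Markov rule while c_{1,2} stays in
    the smaller algebra. *)
Lemma tr_ctl1_vanish n m : tr (ctl 1) = 0 -> subY n.+3 m -> tr (ctl 1 * m) = 0.
Proof.
move=> c0; suff H : forall m, subY n.+3 m -> tr (m * ctl 1) = 0 * tr m.
  by move=> /H; rewrite trC mul0r.
(* The reformulation with factor 0 makes the claim an instance of [span_functional]. *)
elim: n {m} => [|n IHn] m.
  apply: span_functional => _ [w + ->]; rewrite mul0r trC.
  elim: w => [_|l w IHw]; first by rewrite /ev big_nil mulr1.
  rewrite /inY /= => /andP[nl /IHw trw]; rewrite /ev big_cons mulrA -/(ev w).
  case: l nl => i ni; last by rewrite ctl_t.
  by rewrite ctl_g // -?scalerAl ?linearZ /= ?trw ?mulr0 //; lia.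
have nc : subY n.+3 (ctl 1) by apply: subY_ctl.
move=> /subY_span; apply: span_functional.
move=> _ [[b [c [_ nb nc' ->]]]|[b [s [nb ->]]]].
  rewrite mul0r -mulrA trC mulrA tr_subY_g //; last exact: subYM (subYM nc' nc) nb.
  by rewrite trC mulrA IHn ?mul0r ?mulr0 //; apply: subYM.
rewrite mul0r trC mulrA tr_subY_t //; last exact: subYM.
by rewrite trC IHn // mul0r mulr0.
Qed.

(** With c_{i+1,i+2} = h c_{i,i+1} h^{-1}, cyclicity replaces m by h^{-1} m h, which is still in
    Y_{d,n}; induction leads down to c_{1,2}. *)
Lemma tr_ctl_vanish n i m : tr (ctl 1) = 0 -> (0 < i)%N -> (i.+2 <= n)%N ->
  subY n m -> tr (ctl i * m) = 0.
Proof.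
move=> c0; case: i => // i _; elim: i m => [|i IHi] m ni nm.
  by case: n ni nm => [|[|[|n]]] // _; apply: tr_ctl1_vanish.
pose h := g i.+1 * g i.+2 * g i.+3.
pose h' := ginv i.+3 * ginv i.+2 * ginv i.+1.
have hV : h * h' = 1.
  have gK j y : (0 < j)%N -> y * g j * ginv j = y.
    by move=> j0; rewrite -mulrA mulgV // mulr1.
  by rewrite /h' 2!mulrA /h !gK // mulgV.
have -> : ctl i.+2 = h * ctl i.+1 * h' by rewrite ctl_shift // -mulrA hV mulr1.
rewrite -(mulrA (h * _)) -(mulrA h) trC -(mulrA (ctl _)); apply: IHi; first by lia.
have nh : subY n h by apply: subYM; first apply: subYM; apply: subY_g; lia.
have nh' : subY n h' by apply: subYM; first apply: subYM; apply: subY_ginv; lia.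
exact: subYM (subYM nh' nm) nh.
Qed.

(** Summing over k first decouples the convolution: for each fixed s, the x_{k+s} run through a full
    period. *)
Lemma sum_Em : \sum_(k < d) Em d x k = d%:R^-1 * xs ^+ 2.
Proof.
rewrite -mulr_sumr; congr (_ * _); rewrite exchange_big /=.
have per k : xm d x (k + d) = xm d x k by rewrite /xm modnDr.
rewrite (eq_bigr (fun s : 'I_d => xs * xm d x (d - s))) => [|s _].
  by rewrite -mulr_sumr expr2; congr (_ * _); apply: (sum_reflect per 0).
rewrite -mulr_suml -(sum_shift per s); congr (_ * _).
by apply: eq_bigr => k _; rewrite addnC.
Qed.

(** Summing over k turns the e_1^{(k)} into N_1 N_2 / d. Then N_2 absorbs the powers of t_2 in e_2,
    leaving N_1 N_2 N_3 / d^2. *)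
Lemma tr_sum_e1e2 :
  tr (\sum_(k < d) (d%:R^-1 *: \sum_(s < d) t 1%N ^+ (k + s) * t 2 ^+ (d - s))
       * idem 2) = d%:R^-2 * xs ^+ 3.
Proof.
have tper j i : (0 < i)%N -> t i ^+ (j + d) = t i ^+ j.
  by move=> i0; rewrite exp_per ?t_order.
rewrite -mulr_suml -scaler_sumr exchange_big /=.
rewrite (eq_bigr (fun s : 'I_d => csum d (t 1%N) * t 2 ^+ (d - s))); last first.
  move=> s _; rewrite -mulr_suml; congr (_ * _).
  rewrite /csum -[RHS](sum_shift (fun j => tper j 1%N isT) s).
  by apply: eq_bigr => k _; rewrite addnC.
rewrite -mulr_sumr (sum_reflect (fun j => tper j 2 isT) 0) -/(csum d (t 2)).
rewrite idem_def // -scalerAl -scalerAr scalerA mulr_sumr.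
rewrite (eq_bigr (fun s : 'I_d => csum d (t 1%N) * csum d (t 2) * t 3 ^+ (d - s))).
  rewrite -mulr_sumr (sum_reflect (fun j => tper j 3 isT) 0) -/(csum d (t 3)).
  by rewrite linearZ /= tr_T3 expr2 invfM.
by move=> s _; rewrite mulrA -[_ * _ * t 2 ^+ s]mulrA csum_absorb ?t_order.
Qed.

Lemma tr_ctl1E : tr (ctl 1) = d%:R ^+ 2 *
  ((u + 1) * z ^+ 2 * xs + (u + 2) * z * (\sum_(k < d) Em d x k) +
   tr (\sum_(k < d) (d%:R^-1 *: \sum_(s < d) t 1%N ^+ (k + s) * t 2 ^+ (d - s))
       * idem 2)).
Proof. by rewrite tr_ctl1 tr_sum_e1e2 sum_Em; field. Qed.

End YokonumaHecke.

(** * The free algebra modulo the radical of a trace form. Letters receive the choice structure that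
    representatives of classes require *)

Definition letter_code l : nat + nat :=
  match l with G i => inl i | T i => inr i end.
Definition letter_decode s := match s with inl i => G i | inr i => T i end.
Lemma letter_codeK : cancel letter_code letter_decode. Proof. by case. Qed.
HB.instance Definition _ := Choice.copy letter (can_type letter_codeK).

Section TraceQuotient.
Local Open Scope quotient_scope.
Variables (C : fieldType) (f : word -> C).
Implicit Types p q r : fa C.

(** The scalar f(a p b). Using contexts on both sides makes equality of these values a congruence
    for the product even before f is known to be cyclic. *)
Definition sandwich p (a b : word) : C :=
  \sum_(cw <- p) cw.1 * f (a ++ cw.2 ++ b).

Lemma sandwich_add p q a b :
  sandwich (fadd p q) a b = sandwich p a b + sandwich q a b.
Proof. exact: big_cat. Qed.

Lemma sandwich_scale c p a b : sandwich (fscale c p) a b = c * sandwich p a b.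
Proof.
rewrite /sandwich big_map mulr_sumr.
by apply: eq_bigr => cw _; rewrite mulrA.
Qed.

Lemma sandwich_mull p q a b :
  sandwich (fmul p q) a b = \sum_(x <- p) x.1 * sandwich q (a ++ x.2) b.
Proof.
rewrite /sandwich big_allpairs_dep; apply: eq_bigr => x _.
by rewrite mulr_sumr; apply: eq_bigr => y _; rewrite mulrA -!catA.
Qed.

Lemma sandwich_mulr p q a b :
  sandwich (fmul p q) a b = \sum_(y <- q) y.1 * sandwich p a (y.2 ++ b).
Proof.
rewrite /sandwich big_allpairs_dep exchange_big; apply: eq_bigr => y _.
by rewrite mulr_sumr; apply: eq_bigr => x _; rewrite mulrCA mulrA -!catA.
Qed.

Definition trace_equiv p q : bool := `[< sandwich p =2 sandwich q >].

Lemma trace_equiv_is_equiv : equiv_class_of trace_equiv.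
Proof.
split=> [p|p q|q p r].
- by apply/asboolP.
- by apply/asboolP/asboolP => H a b.
- by move=> /asboolP H1 /asboolP H2; apply/asboolP => a b; rewrite H1.
Qed.

Canonical trace_equiv_equiv := EquivRelPack trace_equiv_is_equiv.

(* The free algebra modulo the radical of the trace form (p, q) |-> f (p q);
   the argument keeps the quotient nontrivial. *)
Definition trace_quot of f [::] = 1 := {eq_quot trace_equiv}.

Variable f1 : f [::] = 1.
Local Notation A := (trace_quot f1).
HB.instance Definition _ := Choice.on A.
HB.instance Definition _ := EqQuotient.on A.

Definition cls p : A := \pi_A p.
Definition rep (x : A) : fa C := repr x.

Lemma clsP p q : cls p = cls q <-> sandwich p =2 sandwich q.
Proof.
split=> [/eqP|H]; rewrite /cls; last by apply/eqP; rewrite eqmodE; apply/asboolP.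
by rewrite eqmodE => /asboolP.
Qed.

Lemma repK x : cls (rep x) = x. Proof. exact: reprK. Qed.

Lemma sandwich_rep p : sandwich (rep (cls p)) =2 sandwich p.
Proof. by apply/clsP; rewrite repK. Qed.

Definition qadd x y := cls (fadd (rep x) (rep y)).
Definition qscale c x := cls (fscale c (rep x)).
Definition qmul x y := cls (fmul (rep x) (rep y)).

Lemma clsD p q : qadd (cls p) (cls q) = cls (fadd p q).
Proof. by apply/clsP => a b; rewrite !sandwich_add !sandwich_rep. Qed.

Lemma clsZ c p : qscale c (cls p) = cls (fscale c p).
Proof. by apply/clsP => a b; rewrite !sandwich_scale !sandwich_rep. Qed.

(** One factor is replaced at a time, the words of the other being moved into the context. *)
Lemma clsM p q : qmul (cls p) (cls q) = cls (fmul p q).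
Proof.
apply/clsP => a b; rewrite !sandwich_mull.
under eq_bigr do rewrite sandwich_rep.
rewrite -!sandwich_mull !sandwich_mulr.
by under eq_bigr do rewrite sandwich_rep.
Qed.

Lemma qaddA : associative qadd.
Proof.
move=> x y w; rewrite -[x]repK -[y]repK -[w]repK !clsD.
by apply/clsP => a b; rewrite !sandwich_add addrA.
Qed.

Lemma qaddC : commutative qadd.
Proof.
move=> x y; rewrite -[x]repK -[y]repK !clsD.
by apply/clsP => a b; rewrite !sandwich_add addrC.
Qed.

Lemma qadd0 : left_id (cls [::]) qadd.
Proof.
move=> x; rewrite -[x]repK clsD.
by apply/clsP.
Qed.

Lemma qaddN : left_inverse (cls [::]) (qscale (-1)) qadd.
Proof.
move=> x; rewrite -[x]repK clsZ clsD; apply/clsP => a b.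
by rewrite sandwich_add sandwich_scale mulN1r addNr /sandwich big_nil.
Qed.

HB.instance Definition _ := GRing.isZmodule.Build A qaddA qaddC qadd0 qaddN.

Lemma qmulA : associative qmul.
Proof.
move=> x y w; rewrite -[x]repK -[y]repK -[w]repK !clsM; apply/clsP => a b.
rewrite sandwich_mull [RHS]sandwich_mulr.
under eq_bigr do rewrite sandwich_mulr mulr_sumr.
rewrite exchange_big; apply: eq_bigr => z _; rewrite sandwich_mull mulr_sumr.
by apply: eq_bigr => v _; rewrite mulrCA.
Qed.

Lemma qmul1l : left_id (cls fone) qmul.
Proof.
move=> x; rewrite -[x]repK clsM; apply/clsP => a b.
by rewrite sandwich_mull big_seq1 mul1r cats0.
Qed.

Lemma qmul1r : right_id (cls fone) qmul.
Proof.
move=> x; rewrite -[x]repK clsM; apply/clsP => a b.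
by rewrite sandwich_mulr big_seq1 mul1r.
Qed.

Lemma qmulDl : left_distributive qmul qadd.
Proof.
move=> x y w; rewrite -[x]repK -[y]repK -[w]repK !(clsM, clsD).
by apply/clsP => a b; rewrite sandwich_add !sandwich_mull big_cat.
Qed.

Lemma qmulDr : right_distributive qmul qadd.
Proof.
move=> x y w; rewrite -[x]repK -[y]repK -[w]repK !(clsM, clsD).
by apply/clsP => a b; rewrite sandwich_add !sandwich_mulr big_cat.
Qed.

Lemma qone_neq0 : cls fone != cls [::].
Proof.
apply/eqP => /clsP /(_ [::] [::]); rewrite /sandwich big_seq1 big_nil /= f1 mulr1.
by apply/eqP; rewrite oner_eq0.
Qed.

HB.instance Definition _ :=
  GRing.Zmodule_isNzRing.Build A qmulA qmul1l qmul1r qmulDl qmulDr qone_neq0.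

Lemma qscaleA c c' x : qscale c (qscale c' x) = qscale (c * c') x.
Proof.
rewrite -[x]repK !clsZ; apply/clsP => a b.
by rewrite !sandwich_scale mulrA.
Qed.

Lemma qscale1 : left_id 1 qscale.
Proof.
by move=> x; rewrite -[x]repK !clsZ; apply/clsP => a b; rewrite sandwich_scale mul1r.
Qed.

Lemma qscaleDr : right_distributive qscale +%R.
Proof.
move=> c x y; rewrite -[x]repK -[y]repK [_ + _]clsD !clsZ [RHS]clsD.
by apply/clsP => a b; rewrite sandwich_scale !sandwich_add !sandwich_scale mulrDr.
Qed.

Lemma qscaleDl x : {morph qscale^~ x : c c' / c + c'}.
Proof.
move=> c c'; rewrite -[x]repK !clsZ [RHS]clsD.
by apply/clsP => a b; rewrite !(sandwich_scale, sandwich_add) mulrDl.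
Qed.

HB.instance Definition _ :=
  GRing.Zmodule_isLmodule.Build C A qscaleA qscale1 qscaleDr qscaleDl.

Lemma qscaleAl c (x y : A) : c *: (x * y) = (c *: x) * y.
Proof.
rewrite -[x]repK -[y]repK [_ * _]clsM [LHS]clsZ [c *: _]clsZ [RHS]clsM.
apply/clsP => a b; rewrite sandwich_scale !sandwich_mulr mulr_sumr.
by apply: eq_bigr => v _; rewrite sandwich_scale mulrCA.
Qed.

Lemma qscaleAr c (x y : A) : c *: (x * y) = x * (c *: y).
Proof.
rewrite -[x]repK -[y]repK [_ * _]clsM [LHS]clsZ [c *: _]clsZ [RHS]clsM.
apply/clsP => a b; rewrite sandwich_scale !sandwich_mull mulr_sumr.
by apply: eq_bigr => v _; rewrite sandwich_scale mulrCA.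
Qed.

HB.instance Definition _ := GRing.Lmodule_isLalgebra.Build C A qscaleAl.
HB.instance Definition _ := GRing.Lalgebra_isAlgebra.Build C A qscaleAr.

Lemma cls_add p q : cls (fadd p q) = cls p + cls q.
Proof. exact/esym/clsD. Qed.

Lemma cls_mul p q : cls (fmul p q) = cls p * cls q.
Proof. exact/esym/clsM. Qed.

Lemma cls_scale c p : cls (fscale c p) = c *: cls p.
Proof. exact/esym/clsZ. Qed.

Lemma cls_sum ps : cls (fsum ps) = \sum_(p <- ps) cls p.
Proof.
elim: ps => [|p ps IHps]; first by rewrite big_nil.
by rewrite big_cons -IHps -cls_add.
Qed.

Lemma cls_word w : cls (fw w) =
  ev (fun i => cls (g i)) (fun i => cls (fw [:: T i])) w.
Proof.
elim: w => [|l w IHw]; first by rewrite /ev big_nil.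
rewrite /ev big_cons -/(ev _ _ w) -IHw.
have -> : fw (l :: w) = fmul (fw [:: l]) (fw w) :> fa C.
  by rewrite /fmul /= mul1r.
by rewrite cls_mul; case: l.
Qed.

Lemma cls_tpow i k : cls (tpow i k) = cls (fw [:: T i]) ^+ k.
Proof. by rewrite /tpow cls_word /ev big_nseq iter_mulr_1. Qed.

Definition qtr (x : A) : C := lin f (rep x).

(** The functional descends to classes because it is the sandwich with empty context. *)
Lemma qtr_cls p : qtr (cls p) = lin f p.
Proof.
have := @sandwich_rep p [::] [::]; rewrite /sandwich /qtr /lin.
by under eq_bigr do rewrite cats0; move->; under eq_bigr do rewrite cats0.
Qed.

Lemma qtr_is_scalar : scalar qtr.
Proof.
move=> c x y; rewrite -[x]repK -[y]repK -cls_scale -cls_add !qtr_cls.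
rewrite /lin big_cat big_map mulr_sumr; congr (_ + _).
by apply: eq_bigr => v _; rewrite mulrA.
Qed.

HB.instance Definition _ := GRing.isLinear.Build C A C _ qtr qtr_is_scalar.

Lemma qtrC : (forall a b, f (a ++ b) = f (b ++ a)) ->
  forall x y : A, qtr (x * y) = qtr (y * x).
Proof.
move=> fC x y; rewrite -[x]repK -[y]repK -!cls_mul !qtr_cls.
rewrite /lin !big_allpairs_dep exchange_big.
by do 2![apply: eq_bigr => ? _]; rewrite /= fC mulrC [_.1 * _.1]mulrC mulrC.
Qed.

End TraceQuotient.

(** * Transfer between words with a Markov trace and the quotient algebra *)

Section MarkovTrace.
Variable C : fieldType.
Implicit Types (p q r : fa C) (w : word).

Definition letter_ok l := match l with G i | T i => (0 < i)%N end.
Definition word_ok w := all letter_ok w.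
Definition fa_ok p := all (fun cw => word_ok cw.2) p.

Lemma word_ok_inY n w : inY n w -> word_ok w.
Proof. by apply: sub_all => -[] i; rewrite /letter_ok; lia. Qed.

Lemma word_okP w : word_ok w -> validw w.
Proof.
elim: w => [|l w IHw /= /andP[lok /IHw[n nw]]]; first by exists 0%N.
(* A letter G i needs i < n, hence the successor. *)
exists (maxn n (match l with G i | T i => i.+1 end)); rewrite /inY /=.
apply/andP; split; first by case: l lok => i /=; lia.
by apply: sub_all nw => -[] i; lia.
Qed.

Lemma fa_ok_add p q : fa_ok p -> fa_ok q -> fa_ok (fadd p q).
Proof. by rewrite /fa_ok all_cat => -> ->. Qed.

Lemma fa_ok_scale c p : fa_ok p -> fa_ok (fscale c p).
Proof. by rewrite /fa_ok all_map. Qed.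

Lemma fa_ok_mul p q : fa_ok p -> fa_ok q -> fa_ok (fmul p q).
Proof.
move=> /allP pok /allP qok; apply/allP => _ /allpairsP[[a b] /= [ap bq ->]].
by rewrite /word_ok /= all_cat; apply/andP; split; [apply: pok|apply: qok].
Qed.

Lemma fa_ok_sum ps : all fa_ok ps -> fa_ok (fsum ps).
Proof. by elim: ps => //= p ps IHps /andP[pok /IHps]; apply: fa_ok_add. Qed.

Lemma fa_ok_sum_map (I : Type) (F : I -> fa C) s :
  (forall i, fa_ok (F i)) -> fa_ok (fsum [seq F i | i <- s]).
Proof. by move=> Fok; apply: fa_ok_sum; elim: s => //= i s ->; rewrite Fok. Qed.

Lemma fa_ok_fw w : word_ok w -> fa_ok (fw w).
Proof. by move=> wok; rewrite /fa_ok /= wok. Qed.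

Lemma fa_ok_g i : (0 < i)%N -> fa_ok (g i).
Proof. by move=> i0; rewrite /fa_ok /= i0. Qed.

Lemma fa_ok_tpow i k : (0 < i)%N -> fa_ok (tpow i k).
Proof. by move=> i0; apply: fa_ok_fw; rewrite /word_ok all_nseq /= i0 orbT. Qed.

Lemma fa_ok_e d i m : (0 < i)%N -> fa_ok (e_m d i m).
Proof.
move=> i0; apply/fa_ok_scale/fa_ok_sum_map => s.
by apply: fa_ok_mul; apply: fa_ok_tpow.
Qed.

Lemma fa_ok_c2 d i : (0 < i)%N -> fa_ok (c2 d i).
Proof.
move=> i0; apply: fa_ok_mul.
  apply: fa_ok_sum_map => a; apply: fa_ok_sum; apply/allP.
  move=> _ /allpairsP[[b c] /= [_ _ ->]].
  by do 2?apply: fa_ok_mul; apply: fa_ok_tpow.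
by apply: fa_ok_sum; rewrite /= i0.
Qed.

Variables (d : nat) (u z : C) (x : nat -> C) (tau : word -> C).
Hypothesis d_neq0 : d%:R != 0 :> C.
Hypothesis u_neq0 : u != 0.
Hypothesis tau_markov : is_markov_trace d u z x tau.

(* [is_markov_trace] says nothing about words with a letter of index 0, so
   these are sent to 0. *)
Definition tau0 w : C := if word_ok w then tau w else 0.

Lemma tau0_nil : tau0 [::] = 1.
Proof. by case: tau_markov. Qed.

Lemma tau0C a b : tau0 (a ++ b) = tau0 (b ++ a).
Proof.
rewrite /tau0 /word_ok !all_cat andbC; case: ifP => // /andP[aok bok].
by case: tau_markov => _ tauC _ _ _; apply: tauC; apply: word_okP.
Qed.

Lemma lin_tau0 p : fa_ok p -> lin tau0 p = lin tau p.
Proof.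
move=> /allP pok; apply: eq_big_seq => cw /pok cwok.
by rewrite /tau0 cwok.
Qed.

Local Notation A := (trace_quot tau0_nil).
Local Notation cl := (cls tau0_nil).

(** Contexts containing an index 0 give 0 by the choice of [tau0]; in all others [tau0] agrees with
    [tau], which kills the relation. *)
Lemma cls_rel r : YHrel d u r -> fa_ok r -> cl r = 0.
Proof.
move=> rel rok; apply/clsP => a b; rewrite [RHS]/sandwich big_nil.
case abok: (word_ok a && word_ok b); last first.
  rewrite /sandwich big1_seq // => cw _; rewrite /tau0 /word_ok !all_cat.
  case: ifP => [/and3P[aok _ bok]|]; last by rewrite mulr0.
  by move: abok; rewrite /word_ok aok bok.
have [aok bok] := andP abok.
case: tau_markov => /(_ a b r (word_okP aok) (word_okP bok) rel) <- _ _ _ _.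
rewrite /lin !(big_allpairs_dep, big_seq1) /= exchange_big big_seq1.
apply: eq_big_seq => cw /(allP rok) cwok /=.
have -> : tau0 (a ++ cw.2 ++ b) = tau (a ++ cw.2 ++ b).
  by rewrite /tau0 /word_ok !all_cat -!/(word_ok _) aok cwok bok.
by rewrite mulr1 mul1r -catA.
Qed.

Lemma cls_sub p q : cl (fsub p q) = cl p - cl q.
Proof. by rewrite cls_add cls_scale scaleN1r. Qed.

Lemma cls_rel_eq p q : YHrel d u (fsub p q) -> fa_ok p -> fa_ok q -> cl p = cl q.
Proof.
move=> rel pok qok; apply/eqP; rewrite -subr_eq0 -cls_sub.
by rewrite cls_rel //; apply: fa_ok_add => //; apply: fa_ok_scale.
Qed.

Local Notation qg := (fun i => cl (g i)).
Local Notation qt := (fun i => cl (fw [:: T i])).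
Local Notation qe := (fun i => cl (e_ d i)).

Lemma qggC i j : (0 < i)%N -> (i.+1 < j)%N -> qg i * qg j = qg j * qg i.
Proof.
move=> i0 ij; rewrite -!cls_mul; apply/esym/cls_rel_eq.
- by apply: rel_gg; lia.
- by apply: fa_ok_mul; apply: fa_ok_g; lia.
- by apply: fa_ok_mul; apply: fa_ok_g; lia.
Qed.

Lemma qbraid i : (0 < i)%N -> qg i.+1 * qg i * qg i.+1 = qg i * qg i.+1 * qg i.
Proof.
move=> i0; rewrite -!mulrA -!cls_mul; apply: cls_rel_eq.
- exact: rel_braid.
- by do 2?apply: fa_ok_mul; apply: fa_ok_g.
- by do 2?apply: fa_ok_mul; apply: fa_ok_g.
Qed.

Lemma qttC i j : (0 < i)%N -> (0 < j)%N -> qt i * qt j = qt j * qt i.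
Proof.
move=> i0 j0; rewrite -!cls_mul; apply: cls_rel_eq.
- exact: rel_tt.
- by apply: fa_ok_mul; apply: (fa_ok_tpow 1).
- by apply: fa_ok_mul; apply: (fa_ok_tpow 1).
Qed.

Lemma qt_order i : (0 < i)%N -> qt i ^+ d = 1.
Proof.
move=> i0; rewrite -cls_tpow; apply: (@cls_rel_eq _ fone) => //.
- exact: rel_td.
- exact: fa_ok_tpow.
Qed.

Lemma qgt_l i : (0 < i)%N -> qg i * qt i = qt i.+1 * qg i.
Proof.
move=> i0; rewrite -!cls_mul; apply: cls_rel_eq.
- exact: rel_gt1.
- by apply: fa_ok_mul; [apply: fa_ok_g|exact: (fa_ok_tpow 1)].
- by apply: fa_ok_mul; [exact: (fa_ok_tpow 1)|apply: fa_ok_g].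
Qed.

Lemma qgt_r i : (0 < i)%N -> qg i * qt i.+1 = qt i * qg i.
Proof.
move=> i0; rewrite -!cls_mul; apply: cls_rel_eq.
- exact: rel_gt2.
- by apply: fa_ok_mul; [apply: fa_ok_g|exact: (fa_ok_tpow 1)].
- by apply: fa_ok_mul; [exact: (fa_ok_tpow 1)|apply: fa_ok_g].
Qed.

Lemma qgt_far i j : (0 < i)%N -> (0 < j)%N -> j != i -> j != i.+1 ->
  qg i * qt j = qt j * qg i.
Proof.
move=> i0 j0 ji ji1; rewrite -!cls_mul; apply: cls_rel_eq.
- exact: rel_gt3.
- by apply: fa_ok_mul; [apply: fa_ok_g|exact: (fa_ok_tpow 1)].
- by apply: fa_ok_mul; [exact: (fa_ok_tpow 1)|apply: fa_ok_g].
Qed.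

Lemma sum_iota (V : nmodType) m (F : nat -> V) :
  \sum_(s <- iota 0 m) F s = \sum_(s < m) F s.
Proof. by rewrite -(big_mkord xpredT F) /index_iota subn0. Qed.

Lemma cls_sum_iota (F : nat -> fa C) :
  cl (fsum [seq F s | s <- iota 0 d]) = \sum_(s < d) cl (F s).
Proof. by rewrite cls_sum big_map sum_iota. Qed.

Lemma cls_e_m i m : cl (e_m d i m) =
  d%:R^-1 *: \sum_(s < d) qt i ^+ (m + s) * qt i.+1 ^+ (d - s).
Proof.
rewrite cls_scale cls_sum_iota; congr (_ *: _).
by apply: eq_bigr => s _; rewrite cls_mul !cls_tpow.
Qed.

Lemma qg_quad i : (0 < i)%N ->
  qg i * qg i = 1 + (u - 1) *: qe i + (u - 1) *: (qe i * qg i).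
Proof.
move=> i0; rewrite -addrA -!cls_mul -!cls_scale.
rewrite -[X in 1 + X]cls_add -[RHS](cls_add _ fone).
have eok : fa_ok (e_ d i) by apply: fa_ok_e.
apply: cls_rel_eq; first exact: rel_quad.
  by apply: fa_ok_mul; apply: fa_ok_g.
apply: fa_ok_add => //; apply: fa_ok_add; apply: fa_ok_scale => //.
by apply: fa_ok_mul => //; apply: fa_ok_g.
Qed.

Lemma qtr_g n w : (0 < n)%N -> inY n w ->
  qtr (ev qg qt w * qg n) = z * qtr (ev qg qt w).
Proof.
move=> n0 nw; case: tau_markov => _ _ _ tau_g _.
rewrite -cls_word -cls_mul !qtr_cls /lin !big_seq1 /= !mul1r.
rewrite /tau0 (word_ok_inY nw) -(tau_g n) // -cats1.
by rewrite /word_ok all_cat (word_ok_inY nw : all _ _) /= n0.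
Qed.

Lemma qtr_t n w s : (0 < n)%N -> inY n w -> (1 <= s <= d.-1)%N ->
  qtr (ev qg qt w * qt n.+1 ^+ s) = x s * qtr (ev qg qt w).
Proof.
move=> n0 nw sd; case: tau_markov => _ _ _ _ tau_t.
rewrite -cls_word -cls_tpow -cls_mul !qtr_cls /lin !big_seq1 /= !mul1r.
rewrite /tau0 (word_ok_inY nw) -(tau_t n) //.
by rewrite /word_ok all_cat (word_ok_inY nw : all _ _) all_nseq orbT.
Qed.

Lemma cls_c2 i : cl (c2 d i) = ctl d qg qt i.
Proof.
rewrite cls_mul /ctl; congr (_ * _).
  rewrite cls_sum_iota -mulrA mulr_suml; apply: eq_bigr => a _.
  rewrite cls_sum big_allpairs_dep sum_iota mulr_suml mulr_sumr.
  apply: eq_bigr => b _; rewrite sum_iota !mulr_sumr.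
  by apply: eq_bigr => c _; rewrite !cls_mul !cls_tpow.
by rewrite cls_sum !big_cons big_nil addr0 !cls_mul /gsum !addrA -mulrA.
Qed.

(** Cyclicity gathers the two outer words on one side, so vanishing on the ideal becomes vanishing
    of a functional m |-> tr(c_{i,i+1} m). *)
Lemma lin_tau_c2 i a b : (0 < i)%N -> word_ok a -> word_ok b ->
  lin tau (fmul (fmul (fw a) (c2 d i)) (fw b)) =
  qtr (ctl d qg qt i * (ev qg qt b * ev qg qt a)).
Proof.
move=> i0 aok bok; rewrite -lin_tau0; last first.
  by do 2?apply: fa_ok_mul; rewrite ?fa_ok_fw ?fa_ok_c2.
rewrite -(qtr_cls tau0_nil) 2!cls_mul !cls_word cls_c2 -mulrA.
by rewrite (qtrC tau0C) mulrA.
Qed.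

Lemma sum_lin_tau_e1e2 : \sum_(k < d) lin tau (fmul (e_m d 1 k) (e_ d 2)) =
  qtr (\sum_(k < d) (d%:R^-1 *:
    \sum_(s < d) qt 1%N ^+ (k + s) * qt 2 ^+ (d - s)) * qe 2).
Proof.
rewrite linear_sum; apply: eq_bigr => k _.
rewrite /= -[X in qtr (X * _)]cls_e_m -[X in qtr X]cls_mul qtr_cls.
by rewrite lin_tau0 // fa_ok_mul // fa_ok_e.
Qed.

(** The stated expression times d^2 is tr c_{1,2}, and d is invertible. Necessity takes i = 1 and
    empty words; sufficiency is the propagation from c_{1,2} to all c_{i,i+1}. *)
Lemma passes_to_CTL_iff n : (3 <= n)%N ->
  passes_to_CTL d n tau <->
  (u + 1) * z ^+ 2 * (\sum_(k < d) xm d x k)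
   + (u + 2) * z * (\sum_(k < d) Em d x k)
   + \sum_(k < d) lin tau (fmul (e_m d 1 k) (e_ d 2)) = 0.
Proof.
move=> n3; have qtr1 : qtr (1 : A) = 1.
  by rewrite [LHS](qtr_cls tau0_nil fone) /lin big_seq1 mul1r tau0_nil.
have qe_def i : (0 < i)%N -> qe i =
    d%:R^-1 *: \sum_(s < d) qt i ^+ s * qt i.+1 ^+ (d - s).
  by move=> _; apply: cls_e_m.
set cond := (X in X = 0).
have E : qtr (ctl d qg qt 1) = d%:R ^+ 2 * cond.
  rewrite /cond sum_lin_tau_e1e2.
  exact: (tr_ctl1E d_neq0 u_neq0 qttC qt_order qgt_l qgt_r qgt_far qe_def
    qg_quad (qtrC tau0C) qtr1 qtr_g qtr_t).
have -> : cond = 0 <-> qtr (ctl d qg qt 1) = 0.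
  rewrite E; split=> [->|/eqP]; first by rewrite mulr0.
  by rewrite mulf_eq0 expf_eq0 (negPf d_neq0) /= => /eqP.
split=> [pass|c0 i a b ni na nb].
  have := pass 1%N [::] [::]; rewrite lin_tau_c2 // /ev big_nil !mulr1.
  by apply=> //; lia.
have [aok bok] := (word_ok_inY na, word_ok_inY nb).
rewrite lin_tau_c2 //; last lia.
apply: (tr_ctl_vanish d_neq0 u_neq0 qggC qbraid qttC qt_order qgt_l qgt_r
  qgt_far qe_def qg_quad (qtrC tau0C) qtr_g qtr_t (n := n)) => //; try lia.
by rewrite -ev_cat; apply: subY_ev; rewrite /inY all_cat; apply/andP.
Qed.

End MarkovTrace.

Theorem theorem6 (R : realType) (d n : nat) (u z : R[i]) (x : nat -> R[i])
    (tau : word -> R[i]) :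
  (1 <= d)%N -> (3 <= n)%N -> u != 0 ->
  is_markov_trace d u z x tau ->
  (passes_to_CTL d n tau <->
   (u + 1) * z ^+ 2 * (\sum_(k < d) xm d x k)
   + (u + 2) * z * (\sum_(k < d) Em d x k)
   + \sum_(k < d) lin tau (fmul (e_m d 1 k) (e_ d 2)) = 0).
Proof.
move=> d1 n3 u0 tau_markov; apply: passes_to_CTL_iff => //.
by rewrite pnatr_eq0 -lt0n.
Qed.
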